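(* Let $n \ge 3$. For each vertex $v$ of $P_2 \square C_n$, the domination value satisfies $DV(v) = 1$ if $n \equiv 0 \pmod 4$; $DV(v)=\frac{n+1}{2}$ if $n \equiv 1,3 \pmod 4$ and $n \ne 3$; $DV(v)=\left(\lceil \frac{n+1}{2}\rceil\right)^2$ if $n \equiv 2 \pmod 4$ and $n \ne 6$; $DV(v)=3$ if $n=3$; $DV(v)=17$ if $n=6$.
   Context: $P_2 \square C_n$ is the Cartesian product of the path on 2 vertices with the cycle on $n$ vertices: two copies of $C_n$ with vertices $x_1,\dots,x_n$ and $y_1,\dots,y_n$ (labeled cyclically) together with the edges $x_iy_i$, $1 \le i \le n$. A minimum dominating set of a graph $G$ is a set $D\subseteq V(G)$ of minimum cardinality such that every vertex not in $D$ is adjacent to a vertex of $D$. For $v \in V(G)$, the domination value $DV(v)$ is the number of minimum dominating sets of $G$ containing $v$. *)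

(* Defs.v *)
From mathcomp Require Import all_boot.

Set Implicit Arguments.
Unset Strict Implicit.
Unset Printing Implicit Defensive.

(* A finite simple graph is given by its adjacency relation on a finType,
   meant to be symmetric and irreflexive. *)

Definition dominating (T : finType) (e : rel T) (D : {set T}) : bool :=
  [forall v, (v \notin D) ==> [exists u in D, e v u]].

Definition min_dominating (T : finType) (e : rel T) (D : {set T}) : bool :=
  dominating e D && [forall D' : {set T}, dominating e D' ==> (#|D| <= #|D'|)].

Definition DV (T : finType) (e : rel T) (v : T) : nat :=
  #|[set D : {set T} | min_dominating e D & v \in D]|.

Definition path_graph (n : nat) : rel 'I_n :=
  fun i j => (j == i.+1 :> nat) || (i == j.+1 :> nat).
Arguments path_graph : clear implicits.

(* [ordS i] is i + 1 modulo n; this is the simple graph C_n only for n >= 3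
   (it has loops for n = 1). *)
Definition cycle_graph (n : nat) : rel 'I_n :=
  fun i j => (j == ordS i) || (i == ordS j).
Arguments cycle_graph : clear implicits.

Definition box_product (S T : finType) (eS : rel S) (eT : rel T) :
    rel (S * T)%type :=
  fun u v => ((u.1 == v.1) && eT u.2 v.2) || ((u.2 == v.2) && eS u.1 v.1).

(* A vertex (a, i) is x_i for a = 0 and y_i for a = 1, with i counted from 0. *)
Definition P2_box_C (n : nat) : rel ('I_2 * 'I_n)%type :=
  box_product (path_graph 2) (cycle_graph n).
Arguments P2_box_C : clear implicits.

Lemma path_graph_sym n : symmetric (path_graph n).
Proof. by move=> i j; rewrite /path_graph orbC. Qed.

Lemma path_graph_irrefl n : irreflexive (path_graph n).
Proof. by move=> i; rewrite /path_graph orbb ltn_eqF. Qed.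

Lemma cycle_graph_sym n : symmetric (cycle_graph n).
Proof. by move=> i j; rewrite /cycle_graph orbC. Qed.

Lemma cycle_graph_irrefl n : 1 < n -> irreflexive (cycle_graph n).
Proof.
move=> n_gt1 i; rewrite /cycle_graph orbb -val_eqE /=.
have := ltn_ord i; rewrite leq_eqVlt => /orP[/eqP eq_n|lt_n].
  by rewrite eq_n modnn; apply/eqP => i0; rewrite -eq_n i0 in n_gt1.
by rewrite modn_small // ltn_eqF.
Qed.

Lemma P2_box_C_sym n : symmetric (P2_box_C n).
Proof.
move=> u v; rewrite /P2_box_C /box_product.
by rewrite path_graph_sym cycle_graph_sym (eq_sym u.1) (eq_sym u.2).
Qed.

Lemma P2_box_C_irrefl n : 1 < n -> irreflexive (P2_box_C n).
Proof.
move=> n_gt1 u; rewrite /P2_box_C /box_product.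
by rewrite path_graph_irrefl cycle_graph_irrefl // !andbF.
Qed.

(* Main.v *)
(** Every closed neighbourhood has 4 vertices, so a dominating set D satisfies
4|D| = 2n + x, where the excess x >= 0 counts the superfluous dominations and
x = -2n modulo 4. It turns out that the least possible x is 0, 2 or 4 according as
n is divisible by 4, odd, or 2 modulo 4, so minimum dominating sets are dominating
sets of small excess. Reading D column by column from the vertex v, the excess is a
sum over triples of consecutive columns, hence dominating sets of excess k through v
are closed walks of weight k in a finite automaton. The excess 0 part of its transfer
matrix only has 0 and the fourth roots of unity as eigenvalues, so the walk counts of
bounded excess are eventually annihilated by a power of E^4 - 1, E being the shift. For
excess at most 4 the cube suffices, from 5 on: it is enough to check this at 5, since
the recurrence propagates by linearity, and finitely many values then determine the
counts. *)

Require Import Defs.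
From mathcomp Require Import all_boot.
From mathcomp Require Import all_algebra.
From mathcomp Require Import zify ring.

Set Implicit Arguments.
Unset Strict Implicit.
Unset Printing Implicit Defensive.

Import GRing.Theory.

(** * The automaton on columns *)

Definition column := (bool * bool)%type.

Definition columns : seq column :=
  [:: (true, true); (true, false); (false, true); (false, false)].

(** The first component stands for the row of [v]: a walk starting with such a column comes from a
    set containing [v]. *)
Definition rooted_columns : seq column := [:: (true, true); (true, false)].

(* How often the two vertices of the middle column [b] of three consecutive columns are
   dominated. *)
Definition coverage1 (a b c : column) : nat := a.1 + b.1 + c.1 + b.2.
Definition coverage2 (a b c : column) : nat := a.2 + b.2 + c.2 + b.1.
Definition covered (a b c : column) : bool := (0 < coverage1 a b c) && (0 < coverage2 a b c).
Definition excess (a b c : column) : nat := coverage1 a b c + coverage2 a b c - 2.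

(* Counts the ways to continue a word of columns ending in [a], [b] by [r] columns and
   then close it up with its first two columns [f], [g], so that every column from [b]
   on is covered and the total excess is [k]. *)
Fixpoint walks (f g a b : column) (r k : nat) : nat :=
  if r is r'.+1 then
    sumn [seq if covered a b c && (excess a b c <= k)
              then walks f g b c r' (k - excess a b c) else 0 | c <- columns]
  else [&& covered a b f, covered b f g & excess a b f + excess b f g == k].

Lemma walksS f g a b r k :
  walks f g a b r.+1 k =
  \sum_(c <- columns | covered a b c && (excess a b c <= k))
     walks f g b c r (k - excess a b c).
Proof. by rewrite big_mkcond unlock. Qed.

(** * Recurrence and closed forms for the walk counts *)

(* (E^4 - 1)^3 annihilates [u] at [r], written without subtraction. *)
Definition recurrent (u : nat -> nat) (r : nat) : bool :=
  u (r + 12) + 3 * u (r + 4) == 3 * u (r + 8) + u r.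

(** The pair [a], [b] is not tied to [f], [g]: the induction on [r] moves to arbitrary intermediate
    states with the same closing columns. *)
Lemma walks_recurrent_base :
  all (fun f => all (fun g => all (fun a => all (fun b => all (fun k =>
    recurrent (walks f g a b ^~ k) 5)
    (iota 0 5)) columns) columns) columns) rooted_columns.
Proof. by vm_compute. Qed.

Lemma mem_columns (c : column) : c \in columns.
Proof. by case: c => [[] []]. Qed.

Lemma walks_recurrent f g a b k r :
  f \in rooted_columns -> k <= 4 -> 5 <= r -> recurrent (walks f g a b ^~ k) r.
Proof.
move=> f_root le_k4 le5r; rewrite -(subnK le5r).
elim: {r le5r}(r - 5) a b k le_k4 => [|r IHr] a b k le_k4.
  have /allP/(_ _ f_root)/allP/(_ g (mem_columns g)) := walks_recurrent_base.
  move=> /allP/(_ a (mem_columns a))/allP/(_ b (mem_columns b))/allP.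
  by apply; rewrite mem_iota.
rewrite /recurrent !addSn !walksS !big_distrr -!big_split; apply/eqP/eq_bigr => c _.
by apply/eqP/IHr; rewrite (leq_trans (leq_subr _ _)).
Qed.

Lemma recurrent_sum (I : Type) (s : seq I) (P : pred I) (u : I -> nat -> nat) n :
  (forall i, P i -> recurrent (u i) n) ->
  recurrent (fun m => \sum_(i <- s | P i) u i m) n.
Proof.
move=> rec_u; rewrite /recurrent !big_distrr -!big_split.
by apply/eqP/eq_bigr => i /rec_u/eqP.
Qed.

Lemma recurrent_unique u p m n :
  (forall n, m <= n -> recurrent u n) -> (forall n, m <= n -> recurrent p n) ->
  (forall i, i < 12 -> u (m + i) = p (m + i)) -> m <= n -> u n = p n.
Proof.
move=> rec_u rec_p base; elim/ltn_ind: n => n IHn le_mn.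
have [lt_n12|le12n] := ltnP (n - m) 12.
  by rewrite -(subnKC le_mn) base.
have le_m : m <= n - 12 by lia.
move: (rec_u _ le_m) (rec_p _ le_m); rewrite /recurrent subnK; last by lia.
rewrite !(IHn (n - 12 + _)) ?(IHn (n - 12)); lia.
Qed.

Definition roots : seq (column * column) :=
  [seq (a, b) | a <- rooted_columns, b <- columns].

Definition rooted_walks (r k : nat) : nat :=
  sumn [seq walks p.1 p.2 p.1 p.2 r k | p <- roots].

Lemma rooted_walks_recurrent k r :
  k <= 4 -> 5 <= r -> recurrent (rooted_walks ^~ k) r.
Proof.
move=> le_k4 le5r.
suff: recurrent (fun m => \sum_(p <- roots | p \in roots) walks p.1 p.2 p.1 p.2 m k) r.
  by rewrite /recurrent /rooted_walks !sumnE !big_map -!big_seq.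
apply: recurrent_sum => p /allpairsP[[a b] [a_root _ ->]].
exact: walks_recurrent.
Qed.

(* Meaningful for [k] = 0, 2, 4 only; [r] is n - 2. *)
Definition excess_profile (r k : nat) : nat :=
  match k with
  | 0 => 4 %| r + 2
  | 2 => odd r * (r + 3)./2
  | _ => ~~ odd r * ((r + 4)./2 * (r + 4)./2)
  end.

Lemma rooted_walksE k r :
  k \in [:: 0; 2; 4] -> 5 <= r -> rooted_walks r k = excess_profile r k.
Proof.
move=> k_in; apply: (@recurrent_unique (rooted_walks ^~ k) (excess_profile ^~ k) 5)
  => [n|n _|i lt_i12].
- by apply: rooted_walks_recurrent; move: k_in; rewrite !inE => /or3P[]/eqP->.
- move: k_in; rewrite !inE /recurrent => /or3P[]/eqP-> /=.
  + by lia.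
  (* The shifts 12, 8, 4 keep the parity and move the half by 6, 4, 2. What remains is a third
     difference of a polynomial in [h] of degree at most 2. *)
  + have half2 i : (n + i.*2 + 3)./2 = (n + 3)./2 + i by lia.
    rewrite (half2 6) (half2 4) (half2 2) !oddD !addbF.
    by case: (odd n); rewrite ?mul0n // !mul1n; move: (n + 3)./2 => h; lia.
  + have half2 i : (n + i.*2 + 4)./2 = (n + 4)./2 + i by lia.
    rewrite (half2 6) (half2 4) (half2 2) !oddD !addbF.
    by case: (odd n); rewrite ?mul0n // !mul1n; move: (n + 4)./2 => h; lia.
have /allP : all (fun k => all (fun i => rooted_walks (5 + i) k == excess_profile (5 + i) k)
    (iota 0 12)) [:: 0; 2; 4] by vm_compute.
by move=> /(_ _ k_in)/allP/(_ i); rewrite mem_iota => /(_ lt_i12)/eqP.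
Qed.

(** * Walks as cyclic words *)

Fixpoint fold_triples (A T : Type) (op : A -> A -> A) (idx : A) (F : T -> T -> T -> A)
    (a b : T) (s : seq T) : A :=
  if s is c :: s' then op (F a b c) (fold_triples op idx F b c s') else idx.

Lemma fold_triplesE (A T : Type) (op : A -> A -> A) (idx : A) (F : T -> T -> T -> A)
    (x a b : T) (s : seq T) :
  fold_triples op idx F a b s =
  \big[op/idx]_(0 <= j < size s)
     F (nth x (a :: b :: s) j) (nth x (a :: b :: s) j.+1) (nth x (a :: b :: s) j.+2).
Proof.
elim: s a b => [|c s IHs] a b /=; first by rewrite big_geq.
by rewrite IHs [RHS]big_ltn // big_add1.
Qed.

Lemma sum_tuple_cons (T : finType) (n : nat) (F : n.+1.-tuple T -> nat) :
  \sum_t F t = \sum_(c : T) \sum_(t : n.-tuple T) F [tuple of c :: t].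
Proof.
rewrite pair_big /= (reindex (fun p : T * n.-tuple T => [tuple of p.1 :: p.2])) //=.
exists (fun t => (thead t, [tuple of behead t])) => [[c t]|t] _ /=.
  by congr (_, _); apply/val_inj.
by rewrite -tuple_eta.
Qed.

Lemma sum_columns (F : column -> nat) : \sum_c F c = \sum_(c <- columns) F c.
Proof.
apply/perm_big/uniq_perm => [||c]; rewrite ?index_enum_uniq //.
by rewrite mem_index_enum mem_columns.
Qed.

Definition closed_walk (k : nat) (f g a b : column) (s : seq column) : bool :=
  let w := s ++ [:: f; g] in
  fold_triples andb true covered a b w && (fold_triples addn 0 excess a b w == k).

Lemma walksE f g a b r k :
  walks f g a b r k = \sum_(t : r.-tuple column) closed_walk k f g a b t.
Proof.
elim: r a b k => [|r IHr] a b k.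
  rewrite (big_pred1 [tuple]) => [|t]; last by apply/esym/eqP/tuple0.
  by rewrite /closed_walk /= andbT addn0 andbA.
rewrite walksS big_mkcond sum_tuple_cons sum_columns; apply: eq_bigr => c _.
case: ifP => [/andP[cov_c le_ek]|not_cov].
  rewrite IHr; apply: eq_bigr => t _; rewrite /closed_walk /= cov_c /=.
  by rewrite -(eqn_add2l (excess a b c)) subnKC.
rewrite big1 // => t _; rewrite /closed_walk /=; apply/eqP; rewrite eqb0.
move: not_cov; case: (covered a b c) => //= /negbT; rewrite -ltnNge => lt_ke.
by apply/nandP; right; apply: contraL lt_ke => /eqP <-; rewrite -leqNgt leq_addr.
Qed.

Lemma rooted_walks_sum r k :
  rooted_walks r k =
  \sum_(t : r.+2.-tuple column)
     (nth (false, false) t 0).1 &&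
     closed_walk k (nth (false, false) t 0) (nth (false, false) t 1)
       (nth (false, false) t 0) (nth (false, false) t 1) (drop 2 t).
Proof.
rewrite /rooted_walks sumnE big_map big_allpairs_dep /=.
rewrite -[rooted_columns]/[seq a <- columns | a.1] big_filter big_mkcond.
rewrite sum_tuple_cons sum_columns; apply: eq_bigr => a _.
rewrite sum_tuple_cons sum_columns; case: ifP => a1.
  by apply: eq_bigr => b _; rewrite walksE; apply: eq_bigr => t _; rewrite /= drop0.
by rewrite big1 // => b _; rewrite big1.
Qed.

(** Repeating the first two columns at the end makes a linear fold meet each of the [r.+2] cyclic
    triples exactly once. *)
Lemma fold_cyclic_triples (A : Type) (op : A -> A -> A) (idx : A)
    (F : column -> column -> column -> A) r (t : r.+2.-tuple column) x :
  let a := nth x t 0 in let b := nth x t 1 in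
  let w j := nth x t (j %% r.+2) in
  fold_triples op idx F a b (drop 2 t ++ [:: a; b]) =
  \big[op/idx]_(0 <= j < r.+2) F (w j) (w j.+1) (w j.+2).
Proof.
move=> a b w; rewrite (fold_triplesE _ _ _ x) size_cat size_drop size_tuple /=
  !subSS subn0 addn2.
have nth_w j : j < r.+4 -> nth x (a :: b :: drop 2 t ++ [:: a; b]) j = w j.
  have -> : a :: b :: drop 2 t ++ [:: a; b] = t ++ [:: a; b].
    by rewrite /a /b; case: t {a b w} => [[|? [|? ?]]] //= _; rewrite drop0.
  rewrite /w nth_cat size_tuple; case: (ltnP j r.+2) => [lt_j _|le_j lt_j].
    by rewrite modn_small.
  have lt2 : j - r.+2 < 2 by lia.
  rewrite -[in RHS](subnK le_j) modnDr modn_small; last by lia.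
  by case: (j - r.+2) lt2 => [|[|?]].
by rewrite big_nat [RHS]big_nat; apply: eq_bigr => j /andP[_ lt_j]; rewrite -!nth_w //; lia.
Qed.

(** * Dominating sets read column by column *)

Definition column_at n (D : {set 'I_2 * 'I_n}) (a : 'I_2) (x : 'I_n) : column :=
  ((a, x) \in D, (rev_ord a, x) \in D).

Lemma ordS_add1 r (x : 'I_r.+2) : ordS x = (x + 1)%R.
Proof. by apply/val_inj; rewrite /= [1 %% _]modn_small // addn1. Qed.

Lemma path_graph2 (a b : 'I_2) : path_graph 2 a b = (b == rev_ord a).
Proof. by case: a => [[|[|?]] ?]; case: b => [[|[|?]] ?]. Qed.

Lemma dominatedE r (D : {set 'I_2 * 'I_r.+2}) (a : 'I_2) (x : 'I_r.+2) :
  ((a, x) \notin D) ==> [exists u in D, P2_box_C r.+2 (a, x) u] =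
  (0 < coverage1 (column_at D a (x - 1)%R) (column_at D a x) (column_at D a (x + 1)%R)).
Proof.
rewrite /coverage1 /= !addn_gt0 !lt0b; case: (boolP ((a, x) \in D)) => [_|_] /=.
  by rewrite orbT.
rewrite orbF; apply/existsP/idP => [[[b y] /andP[yD]]|].
  rewrite /P2_box_C /box_product /cycle_graph path_graph2 /= !ordS_add1.
  case/orP=> /andP[/eqP e]; first (move: yD; rewrite -e => yD; case/orP => /eqP e').
  - by rewrite -e' yD orbT.
  - by rewrite e' addrK yD.
  - by move/eqP=> e'; rewrite e -e' yD orbT.
rewrite /P2_box_C /box_product /cycle_graph.
case/orP=> [/orP[]|] uD;
  [exists (a, (x - 1)%R) | exists (a, (x + 1)%R) | exists (rev_ord a, x)].
all: by rewrite uD /= ?path_graph2 !ordS_add1 ?subrK !eqxx ?orbT.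
Qed.

Lemma column_at_rev n (D : {set 'I_2 * 'I_n}) (a : 'I_2) (x : 'I_n) :
  column_at D (rev_ord a) x = ((column_at D a x).2, (column_at D a x).1).
Proof. by rewrite /column_at rev_ordK. Qed.

Lemma ord2E (a b : 'I_2) : (b == a) || (b == rev_ord a).
Proof. by case: a => [[|[|?]] ?]; case: b => [[|[|?]] ?]. Qed.

Lemma dominatingE r (D : {set 'I_2 * 'I_r.+2}) (a : 'I_2) :
  dominating (P2_box_C r.+2) D =
  [forall x, covered (column_at D a (x - 1)%R) (column_at D a x) (column_at D a (x + 1)%R)].
Proof.
apply/forallP/forallP => [dom x|dom [b x]].
  rewrite /covered -dominatedE dom /=.
  by have := dom (rev_ord a, x); rewrite dominatedE !column_at_rev.
have /andP[cov1 cov2] := dom x; rewrite dominatedE.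
by have /orP[/eqP->|/eqP->] := ord2E a b; rewrite ?column_at_rev.
Qed.

Lemma card_columns n (D : {set 'I_2 * 'I_n}) (a : 'I_2) :
  \sum_x ((column_at D a x).1 + (column_at D a x).2) = #|D|.
Proof.
transitivity (\sum_(b : 'I_2) \sum_(x : 'I_n) ((b, x) \in D)).
  rewrite big_split (bigD1 a) //= (big_pred1 (rev_ord a)) // => b /=.
  by case: a => [[|[|?]] ?]; case: b => [[|[|?]] ?].
rewrite pair_bigA -sum1_card [RHS]big_mkcond; apply: eq_bigr => [[b x] _] /=.
by case: (_ \in _).
Qed.

Lemma excessD2 (b c d : column) :
  covered b c d -> excess b c d + 2 =
  (b.1 + b.2) + (c.1 + c.2) + (c.1 + c.2) + (d.1 + d.2).
Proof. by case: b c d => [[] []] [[] []] [[] []]. Qed.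

(** Double counting: by [excessD2] four column sizes are added at each position, and each of the
    four sums is [#|D|] by rotation invariance. *)
Lemma sum_excess r (D : {set 'I_2 * 'I_r.+2}) (a : 'I_2) :
  dominating (P2_box_C r.+2) D ->
  \sum_x excess (column_at D a (x - 1)%R) (column_at D a x) (column_at D a (x + 1)%R)
    + 2 * r.+2 = 4 * #|D|.
Proof.
rewrite (dominatingE D a) => /forallP cov.
rewrite -[X in _ * X]card_ord mulnC -sum_nat_const -big_split /=.
pose h x := (column_at D a x).1 + (column_at D a x).2.
have sum_shift (y : 'I_r.+2) : \sum_x h (x + y)%R = #|D|.
  by rewrite -(card_columns D a) [RHS](reindex_inj (addIr y)).
rewrite (eq_bigr (fun x => h (x - 1)%R + h (x + 0)%R + h (x + 0)%R + h (x + 1)%R)) => [|x _].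
  by rewrite 3!big_split /= !sum_shift !mulSn addn0 !addnA.
by rewrite addr0 /h excessD2.
Qed.

Definition word_from r (a : 'I_2) (i : 'I_r.+2) (D : {set 'I_2 * 'I_r.+2}) :
    r.+2.-tuple column :=
  [tuple column_at D a (i + j)%R | j < r.+2].

Lemma nth_word_from r (a : 'I_2) (i : 'I_r.+2) (D : {set 'I_2 * 'I_r.+2}) x (j : nat) :
  nth x (word_from a i D) (j %% r.+2) = column_at D a (i + j%:R)%R.
Proof.
rewrite -[j %% r.+2]/(nat_of_ord (inZp j : 'I_r.+2)) -tnth_nth tnth_mktuple.
by rewrite -Zp_nat.
Qed.

Lemma word_from_bij r (a : 'I_2) (i : 'I_r.+2) : bijective (@word_from r a i).
Proof.
pose set_of (t : r.+2.-tuple column) : {set 'I_2 * 'I_r.+2} :=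
  [set u | if u.1 == a then (tnth t (u.2 - i)%R).1 else (tnth t (u.2 - i)%R).2].
exists set_of => [D|t].
  apply/setP => [[b x]]; rewrite inE /= tnth_mktuple addrC subrK.
  by have /orP[/eqP->|/eqP->] := ord2E a b; rewrite ?eqxx //; case: eqP => // ->.
apply/eq_from_tnth => j; rewrite tnth_mktuple /column_at !inE /= addrC addKr eqxx.
rewrite (_ : rev_ord a == a = false); first by case: (tnth t j).
by case: a {set_of} => [[|[|?]] ?].
Qed.

Lemma fold_word_from (A : Type) (idx : A) (op : Monoid.com_law idx)
    (F : column -> column -> column -> A) r (a : 'I_2) (i : 'I_r.+2)
    (D : {set 'I_2 * 'I_r.+2}) x :
  let t := word_from a i D in
  fold_triples op idx F (nth x t 0) (nth x t 1) (drop 2 t ++ [:: nth x t 0; nth x t 1]) =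
  \big[op/idx]_y F (column_at D a (y - 1)%R) (column_at D a y) (column_at D a (y + 1)%R).
Proof.
move=> t; rewrite {}/t fold_cyclic_triples big_mkord [RHS](reindex_inj (addrI (i + 1)%R)).
apply: eq_bigr => j _; rewrite !nth_word_from !mulrSr natr_Zp.
(* The word starts at column [i], so its triple number [j] is centred at [i + 1 + j]. *)
by congr (F (column_at D a _) (column_at D a _) (column_at D a _)); ring.
Qed.

(** * Domination values *)

Lemma card_rooted_walks r (v : 'I_2 * 'I_r.+2) (k : nat) :
  #|[set D | [&& dominating (P2_box_C r.+2) D, v \in D & 4 * #|D| == 2 * r.+2 + k]]| =
  rooted_walks r k.
Proof.
case: v => a i; rewrite rooted_walks_sum (reindex (@word_from r a i)); last first.
  exact/onW_bij/word_from_bij.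
rewrite -sum1_card big_mkcond; apply: eq_bigr => D _; rewrite inE.
rewrite /closed_walk !fold_word_from big_andE -dominatingE.
rewrite -[X in nth _ _ X](mod0n r.+2) nth_word_from addr0 /=.
have [dom|] := boolP (dominating _ D); last by rewrite andbF.
by rewrite -(sum_excess a dom) addnC eqn_add2l /=; case: (_ && _).
Qed.

(** By [sum_excess], an excess [k'] can occur only if 4 divides [2 * r.+2 + k'], so only these need
    to be ruled out below [k]. *)
Lemma DV_rooted_walks r k (v : 'I_2 * 'I_r.+2) :
  0 < rooted_walks r k ->
  (forall k', k' < k -> 4 %| 2 * r.+2 + k' -> rooted_walks r k' = 0) ->
  DV (P2_box_C r.+2) v = rooted_walks r k.
Proof.
move=> pos_k zero_lt_k; rewrite -(card_rooted_walks v k); apply: eq_card => D.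
rewrite !inE /min_dominating; case: (boolP (dominating _ D)) => //= dom_D.
rewrite andbC; case: (boolP (v \in D)) => //= vD.
have excess_ge (D' : {set 'I_2 * 'I_r.+2}) :
    dominating (P2_box_C r.+2) D' -> 2 * r.+2 + k <= 4 * #|D'|.
  move=> dom_D'; have := sum_excess ord0 dom_D'; set k' := \sum_x _ => cardD'.
  rewrite -cardD' addnC leq_add2r leqNgt; apply/negP => lt_k'k.
  (* [D'] may avoid [v], but the walk count is the same for every vertex, so any [u] in [D']
     serves. *)
  have /set0Pn[u uD'] : D' != set0.
    apply/negP => /eqP D'0; move: dom_D' => /forallP/(_ v).
    by rewrite D'0 inE /= => /existsP[u]; rewrite inE.
  have := zero_lt_k k' lt_k'k; rewrite addnC cardD' dvdn_mulr // => /(_ isT).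
  rewrite -(card_rooted_walks u k') => /cards0_eq/setP/(_ D'); rewrite !inE.
  by rewrite dom_D' uD' -cardD' addnC eqxx.
apply/forallP/eqP => [min_D|card_D D'].
  apply/eqP; rewrite eqn_leq excess_ge // andbT.
  move: pos_k; rewrite -(card_rooted_walks v k) => /card_gt0P[D']; rewrite inE.
  case/and3P => dom_D' _ /eqP <-; rewrite leq_mul2l /=.
  by have := min_D D'; rewrite dom_D'.
by apply/implyP => /excess_ge; rewrite -card_D leq_mul2l.
Qed.

Theorem theorem4p3 (n : nat) (n_ge3 : 3 <= n) (v : 'I_2 * 'I_n) :
  [/\ n = 0 %[mod 4] -> DV (P2_box_C n) v = 1,
      (n = 1 %[mod 4] \/ n = 3 %[mod 4]) -> n <> 3 ->
        DV (P2_box_C n) v = n.+1 %/ 2,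
      n = 2 %[mod 4] -> n <> 6 -> DV (P2_box_C n) v = uphalf n.+1 ^ 2,
      n = 3 -> DV (P2_box_C n) v = 3
    & n = 6 -> DV (P2_box_C n) v = 17].
Proof.
case: n n_ge3 v => [|[|r]] // r_gt0 v.
have DV0 : rooted_walks r 0 = 1 -> DV (P2_box_C r.+2) v = 1.
  by move=> E; rewrite (DV_rooted_walks v (k := 0)) ?E.
(* Here n = [r.+2]. For n odd the divisibility forces [k'] to be 2 modulo 4; for n even it leaves
   only 0 below 4, which [w0] excludes. *)
have DV2 : odd r -> 0 < rooted_walks r 2 -> DV (P2_box_C r.+2) v = rooted_walks r 2.
  by move=> odd_r pos; apply: DV_rooted_walks => // k' lt_k'; lia.
have DV4 : rooted_walks r 0 = 0 -> ~~ odd r -> 0 < rooted_walks r 4 ->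
    DV (P2_box_C r.+2) v = rooted_walks r 4.
  by move=> w0 odd_r pos; apply: DV_rooted_walks => // -[//|k'] lt_k'; lia.
have [le5r|lt_r5] := leqP 5 r.
  move: DV0 DV2 DV4; rewrite !rooted_walksE //= => DV0 DV2 DV4.
  split=> [n0|n13 _|n2 _|n3|n6]; [lia | lia | | lia | lia].
  have even_r : ~~ odd r by lia.
  rewrite even_r !mul1n in DV4; rewrite DV4 // ?muln_gt0; try lia.
  by rewrite (_ : r./2.+2 = (r + 4)./2); [rewrite mulnn | lia].
(* The cases n = 3, 4, 5, 6 lie below the range of the closed forms, and their counts are evaluated
   directly. *)
by move: DV0 DV2 DV4; case: r lt_r5 r_gt0 v => [|[|[|[|[|r]]]]] // _ _ v DV0 DV2 DV4;
  split=> // *; first [exact: DV0 | exact: DV2 | exact: DV4 | lia].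
Qed.
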